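(* Let $p\ge2$ be a real number, let $(\mathbb{R},g)$ be the real line with its canonical metric $g$, let $(N,h)$ be a Riemannian manifold, and let $u:(\mathbb{R},g)\to(N,h)$ be a $p$-biharmonic map satisfying $$\int_{\mathbb{R}}\big(|\tau(u)|^p+|du|^p\big)\,dx<\infty.$$ Then $u$ is constant.
   Context: For a smooth map $u:(M,g)\to(N,h)$ between Riemannian manifolds with $m=\dim M$, let $\tilde\nabla$ denote the connection on the pullback bundle $u^{-1}TN$ induced by the Levi-Civita connection of $(N,h)$, let $\nabla$ be the Levi-Civita connection of $(M,g)$, and let $\{e_i\}_{i=1}^m$ be a local orthonormal frame on $M$. The tension field of $u$ is $\tau(u)=\sum_{i=1}^m\{\tilde\nabla_{e_i}du(e_i)-du(\nabla_{e_i}e_i)\}$, a section of $u^{-1}TN$. Let $\tilde\Delta=\mathrm{Tr}_g(\tilde\nabla)^2$ be the rough Laplacian on sections of $u^{-1}TN$, and let $R^N$ be the curvature tensor of $(N,h)$, with the sign convention that $h(R^N(X,Y)Y,X)$ is the sectional curvature of $\mathrm{span}\{X,Y\}$ for orthonormal $X,Y$. The $p$-bitension field is $$\tau_p(u)=p\Big\{\tilde\Delta\big(|\tau(u)|^{p-2}\tau(u)\big)+\sum_{i=1}^m R^N\big(|\tau(u)|^{p-2}\tau(u),du(e_i)\big)du(e_i)\Big\}.$$ A smooth map $u$ is called $p$-biharmonic if $\tau_p(u)=0$ (this is the Euler-Lagrange equation of $E_p(u)=\int_M|\tau(u)|^p\,dv_g$). Here $M=\mathbb{R}$, $m=1$.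 *)

(* Defs.v *)
From mathcomp Require Import all_boot all_order all_algebra.
From mathcomp Require Import all_classical all_reals all_analysis.
From mathcomp Require Import ring lra.

Set Implicit Arguments.
Unset Strict Implicit.
Unset Printing Implicit Defensive.

Import Order.TTheory GRing.Theory Num.Theory.
Import numFieldNormedType.Exports.

Local Open Scope classical_set_scope.
Local Open Scope ring_scope.

Definition pderiv (R : realType) (n : nat) (a : 'I_n) (f : 'rV[R]_n -> R) :
  'rV[R]_n -> R := fun x => 'D_(delta_mx 0 a) f x.

(* C^oo on U (meant for open U): every iterated partial derivative exists and
   is Frechet differentiable, hence continuous, at every point of U. *)
Definition smooth_on (R : realType) (n : nat) (U : set 'rV[R]_n)
    (f : 'rV[R]_n -> R) : Prop :=
  forall (s : seq 'I_n) (x : 'rV[R]_n), U x ->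
    differentiable (foldr (@pderiv R n) f s) x.

(* A homeomorphism from the open set [cdom] of N onto an open subset of R^n.
   [cmap] and [cinv] are total functions; their values off [cdom] and off
   [cimage] are irrelevant. *)
Record chart (R : realType) (n : nat) (N : topologicalType) := Chart {
  cdom : set N;
  cmap : N -> 'rV[R]_n;
  cinv : 'rV[R]_n -> N;
  cdom_open : open cdom;
  cimage_open : open (cmap @` cdom);
  cmapK : forall q, cdom q -> cinv (cmap q) = q;
  cmap_continuous : forall q, cdom q -> {for q, continuous cmap};
  cinv_continuous : forall x, (cmap @` cdom) x -> {for x, continuous cinv} }.

Definition cimage (R : realType) (n : nat) (N : topologicalType)
  (c : chart R n N) : set 'rV[R]_n := cmap c @` cdom c.

Record smoothManifold (R : realType) (n : nat) := SmoothManifold {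
  carrier :> topologicalType;
  carrier_hausdorff : hausdorff_space carrier;
  carrier_second_countable : @second_countable carrier;
  chart_index : Type;
  atlas : chart_index -> chart R n carrier;
  atlas_cover : forall q : carrier, exists i, cdom (atlas i) q;
  atlas_smooth : forall (i j : chart_index) (k : 'I_n),
    smooth_on (cmap (atlas i) @` (cdom (atlas i) `&` cdom (atlas j)))
      (fun x => cmap (atlas j) (cinv (atlas i) x) 0 k) }.

Arguments chart_index {R n} N : rename.
Arguments atlas {R n N} i : rename.

Definition inner (R : realType) (n : nat) (H : 'M[R]_n) (v w : 'rV[R]_n) : R :=
  (v *m H *m w^T) 0 0.

(* [hmx i x] is the Gram matrix of the metric in the chart [i], at the point
   with coordinates [x]. The library's Jacobian acts on row vectors from the
   right, so that [hmx_compat] is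
   h_i (d/dx_a, d/dx_b) = sum_(k, l) dy_k/dx_a dy_l/dx_b h_j (d/dy_k, d/dy_l),
   i.e. the transformation law of a (0,2)-tensor field. *)
Record riemannianMetric (R : realType) (n : nat) (N : smoothManifold R n) :=
  RiemannianMetric {
  hmx : chart_index N -> 'rV[R]_n -> 'M[R]_n;
  hmx_smooth : forall (i : chart_index N) (a b : 'I_n),
    smooth_on (cimage (atlas i)) (fun x => hmx i x a b);
  hmx_sym : forall (i : chart_index N) (x : 'rV[R]_n),
    cimage (atlas i) x -> (hmx i x)^T = hmx i x;
  hmx_pos : forall (i : chart_index N) (x v : 'rV[R]_n),
    cimage (atlas i) x -> v != 0 -> 0 < inner (hmx i x) v v;
  hmx_compat : forall (i j : chart_index N) (q : N),
    cdom (atlas i) q -> cdom (atlas j) q ->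
    let J := jacobian (fun x => cmap (atlas j) (cinv (atlas i) x))
                      (cmap (atlas i) q) in
    hmx i (cmap (atlas i) q) = J *m hmx j (cmap (atlas j) q) *m J^T }.

Section LocalGeometry.
Variables (R : realType) (n : nat).
Variables (N : smoothManifold R n) (h : riemannianMetric N).
Variable i : chart_index N.

(* Gamma^k_{ab} of the Levi-Civita connection:
   nabla_{d_a} d_b = sum_k Gamma^k_{ab} d_k. *)
Definition christoffel (k a b : 'I_n) (x : 'rV[R]_n) : R :=
  2^-1 * \sum_(l < n) invmx (hmx h i x) k l *
    (pderiv a (fun y => hmx h i y b l) x
     + pderiv b (fun y => hmx h i y a l) x
     - pderiv l (fun y => hmx h i y a b) x).

(* The d_k-component of R(d_a, d_b) d_c, where
   R(X, Y)Z = nabla_X nabla_Y Z - nabla_Y nabla_X Z - nabla_[X,Y] Z; with this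
   sign h(R(X, Y)Y, X) is the sectional curvature for orthonormal X, Y. *)
Definition riemann_coef (k a b c : 'I_n) (x : 'rV[R]_n) : R :=
  pderiv a (christoffel k b c) x - pderiv b (christoffel k a c) x
  + \sum_(l < n) (christoffel l b c x * christoffel k a l x
                  - christoffel l a c x * christoffel k b l x).

Definition riemann (x X Y Z : 'rV[R]_n) : 'rV[R]_n :=
  \row_k \sum_(a < n) \sum_(b < n) \sum_(c < n)
    riemann_coef k a b c x * X 0 a * Y 0 b * Z 0 c.

Lemma hmx_unitmx x : cimage (atlas i) x -> hmx h i x \in unitmx.
Proof.
move=> ix; rewrite -row_free_unit -kermx_eq0.
apply/negPn/negP => /rowV0Pn[v /sub_kermxP vH v0].
by have := hmx_pos h ix v0; rewrite /inner vH mul0mx mxE ltxx.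
Qed.

Lemma pderiv_hmxC c a b x : cimage (atlas i) x ->
  pderiv c (fun y => hmx h i y a b) x = pderiv c (fun y => hmx h i y b a) x.
Proof.
move=> ix; apply: near_eq_derive.
have : nbhs x (cimage (atlas i)).
  by apply: open_nbhs_nbhs; split=> //; exact: cimage_open.
by apply: filterS => y iy; rewrite -[in LHS](hmx_sym h iy) mxE.
Qed.

Lemma christoffelC k a b x :
  cimage (atlas i) x -> christoffel k a b x = christoffel k b a x.
Proof.
move=> ix; congr (_ * _); apply: eq_bigr => l _; congr (_ * _).
by rewrite (pderiv_hmxC l a b)// [pderiv a _ _ + _]addrC.
Qed.

Lemma christoffel_lower a b c x : cimage (atlas i) x ->
  \sum_(k < n) christoffel k a b x * hmx h i x k c =
  2^-1 * (pderiv a (fun y => hmx h i y b c) x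
          + pderiv b (fun y => hmx h i y a c) x
          - pderiv c (fun y => hmx h i y a b) x).
Proof.
move=> ix; rewrite /christoffel.
under eq_bigr do rewrite -mulrA mulr_suml.
rewrite -mulr_sumr exchange_big/=; congr (_ * _).
have HV l : \sum_(k < n) invmx (hmx h i x) k l * hmx h i x k c = (c == l)%:R.
  have /matrixP/(_ c l) := mulmxV (hmx_unitmx ix); rewrite !mxE => <-.
  by apply: eq_bigr => k _; rewrite mulrC -{1}(hmx_sym h ix) mxE.
under eq_bigr => l _.
  under eq_bigr do rewrite mulrAC.
  rewrite -mulr_suml HV; over.
rewrite (bigD1 c)//= eqxx mul1r [X in _ + X]big1 ?addr0// => l lc.
by rewrite eq_sym (negbTE lc) mul0r.
Qed.

(* Together with [christoffelC] (no torsion), this metric compatibility is the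
   characterization of the Levi-Civita connection. *)
Lemma christoffel_metric a b c x : cimage (atlas i) x ->
  pderiv c (fun y => hmx h i y a b) x =
  \sum_(k < n) (christoffel k c a x * hmx h i x k b
                + christoffel k c b x * hmx h i x a k).
Proof.
move=> ix; rewrite big_split/= christoffel_lower//.
under [X in _ + X]eq_bigr do rewrite -{1}(hmx_sym h ix) mxE.
rewrite christoffel_lower// (pderiv_hmxC c b a)//; lra.
Qed.

End LocalGeometry.

Definition smooth_curve (R : realType) (n : nat) (N : smoothManifold R n)
    (u : R -> N) : Prop :=
  continuous u /\
  forall (i : chart_index N) (k : nat) (t : R), cdom (atlas i) (u t) ->
    derivable (derive1n k (fun s => cmap (atlas i) (u s))) t 1.

(* The domain is the line with its canonical metric: m = 1, the orthonormal
   frame is e_1 = d/dx and nabla_{e_1} e_1 = 0.  A section of u^-1 TN is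
   represented in the chart [i] by its components, a function R -> R^n which is
   meaningful at the t with u t in the domain of [i]. *)
Section Curves.
Variables (R : realType) (n : nat).
Variables (N : smoothManifold R n) (h : riemannianMetric N) (u : R -> N).

Section InChart.
Variable i : chart_index N.

Definition coord (t : R) : 'rV[R]_n := cmap (atlas i) (u t).

(* du(e_1) *)
Definition velocity : R -> 'rV[R]_n := derive1 coord.

(* The pullback of the Levi-Civita connection, in the direction e_1. *)
Definition cov (V : R -> 'rV[R]_n) (t : R) : 'rV[R]_n :=
  derive1 V t + \row_k \sum_(a < n) \sum_(b < n)
    christoffel h i k a b (coord t) * velocity t 0 a * V t 0 b.

Definition sec_norm (V : R -> 'rV[R]_n) (t : R) : R :=
  Num.sqrt (inner (hmx h i (coord t)) (V t) (V t)).

Definition tension : R -> 'rV[R]_n := cov velocity.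

(* |tau|^(p-2) tau.  For p = 2 the factor is 1 also where tau = 0, as
   0 `^ 0 = 1. *)
Definition ptension (p : R) (t : R) : 'rV[R]_n :=
  (sec_norm tension t `^ (p - 2)) *: tension t.

Definition pbitension (p : R) (t : R) : 'rV[R]_n :=
  p *: (cov (cov (ptension p)) t
        + riemann h i (coord t) (ptension p t) (velocity t) (velocity t)).

End InChart.

(* |tau|^(p-2) tau need not be smooth at the zeros of tau; that it is twice
   differentiable is what it takes for tau_p(u) to be defined. *)
Definition pbiharmonic (p : R) : Prop :=
  smooth_curve u /\
  forall (i : chart_index N) (t : R), cdom (atlas i) (u t) ->
    [/\ derivable (ptension i p) t 1,
        derivable (cov i (ptension i p)) t 1 &
        pbitension i p t = 0].

(* Some chart around q, to evaluate scalars that do not depend on the chart. *)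
Definition chart_at (q : N) : chart_index N := projT1 (cid (atlas_cover q)).

Definition tension_norm (t : R) : R :=
  let i := chart_at (u t) in sec_norm i (tension i) t.

Definition differential_norm (t : R) : R :=
  let i := chart_at (u t) in sec_norm i (velocity i) t.

End Curves.

(* Main.v *)
Require Import Defs.
From mathcomp Require Import all_boot all_order all_algebra.
From mathcomp Require Import all_classical all_reals all_analysis.
From mathcomp Require Import measurable_realfun.
From mathcomp Require Import ring lra.

(** The idea is that the p-biharmonic equation of a curve has a first integral,
    as it comes from a variational problem that is invariant under translations
    of the line. Write T for the velocity, tau = D T for the tension, D for the
    covariant derivative along the curve, and V = |tau|^(p-2) tau, so that the
    equation reads D D V + R(V, T)T = 0. The curvature term is orthogonal to T
    ([riemann_orthogonal]), hence <D D V, T> = 0. Also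
    <D V, tau> = (p - 1) <V, D tau> at every point ([cov_ptension]): where tau
    is not zero this is the derivative of a power, and where tau vanishes both
    sides are zero. As <V, tau> = |tau|^p, it follows that

      <D V, T> - (p - 1)/p |tau|^p = C

    is constant ([is_derive_chart_first_integral]), and the flux F = <V, T>
    satisfies F' = C + (2p - 1)/p |tau|^p ([is_derive_chart_flux]).

    Now |F| <= |tau|^p + |T|^p ([chart_flux_le]) is integrable. A function
    with such a derivative and an integrable majorant must be zero: it drifts to
    -oo if C < 0, and is nondecreasing if C >= 0
    ([integrable_affine_growth]). Therefore tau = 0, the curve is a geodesic, its
    speed is constant, and integrability of |T|^p makes the speed zero.

    The objects above are given in charts, and the norms that are integrated are
    evaluated in a chart that may change with every point. So one has to know
    that the tension transforms as a vector, i.e. that the Christoffel symbols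
    obey their transformation law. That law is obtained from the uniqueness of
    the Levi-Civita connection: the difference of the two connections, in one
    chart, is symmetric and metrically antisymmetric, hence zero
    ([connection_mx_transition]). Both this and the antisymmetry of the
    curvature rest on the symmetry of second derivatives ([derive_comm]). To
    keep indices out of sight the Christoffel symbols are contracted with one
    vector into a matrix ([connection_mx]), and Leibniz rules for products of
    matrices are used throughout. *)

Set Implicit Arguments.
Unset Strict Implicit.
Unset Printing Implicit Defensive.

Import Order.TTheory GRing.Theory Num.Theory.
Import numFieldNormedType.Exports.

Local Open Scope classical_set_scope.
Local Open Scope ring_scope.

(** * Calculus of matrix-valued functions *)

Lemma addmx_entry {R : realType} {m n} (A B : 'M[R]_(m, n)) i j :
  (A + B) i j = A i j + B i j.
Proof. by rewrite mxE. Qed.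

Lemma oppmx_entry {R : realType} {m n} (A : 'M[R]_(m, n)) i j :
  (- A) i j = - A i j.
Proof. by rewrite mxE. Qed.

Section MatrixDerivative.
Context {R : realType} {V : normedModType R}.
Implicit Types (x v : V).

Lemma is_derive_mxP {m n} (M : V -> 'M[R]_(m, n)) x v (dM : 'M[R]_(m, n)) :
  is_derive x v M dM <->
  forall i j, is_derive x v (fun y => M y i j) (dM i j).
Proof.
split=> [[Mx <-] i j|Mx].
  apply: DeriveDef; first by move/derivable_mxP : Mx.
  by rewrite derive_mx// mxE.
have Md : derivable M x v by apply/derivable_mxP => i j; case: (Mx i j).
apply: DeriveDef => //; rewrite derive_mx//.
by apply/matrixP => i j; rewrite mxE; case: (Mx i j).
Qed.

Lemma is_derive_ext {W : normedModType R} (f g : V -> W) x v df dg :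
  f =1 g -> df = dg -> is_derive x v f df -> is_derive x v g dg.
Proof. by move=> /funext -> ->. Qed.

Lemma derivable_ext {W : normedModType R} (f g : V -> W) x v :
  f =1 g -> derivable f x v -> derivable g x v.
Proof. by move=> /funext ->. Qed.

Lemma is_derive_mulmx {m n q} (A : V -> 'M[R]_(m, n)) (B : V -> 'M[R]_(n, q))
    x v dA dB :
  is_derive x v A dA -> is_derive x v B dB ->
  is_derive x v (fun y => A y *m B y) (dA *m B x + A x *m dB).
Proof.
move=> /is_derive_mxP Ax /is_derive_mxP Bx; apply/is_derive_mxP => i j.
have := is_derive_sum (fun k => is_deriveM (Ax i k) (Bx k j)).
apply: is_derive_ext => [y|].
  by rewrite mxE fct_sumE.
rewrite !mxE -big_split/=; apply: eq_bigr => k _.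
by rewrite addrC /GRing.scale/= (mulrC (B x k j)).
Qed.

Lemma is_derive_trmx {m n} (A : V -> 'M[R]_(m, n)) x v dA :
  is_derive x v A dA -> is_derive x v (fun y => (A y)^T) dA^T.
Proof.
move=> /is_derive_mxP Ax; apply/is_derive_mxP => i j.
by apply: is_derive_ext (Ax j i) => [y|]; rewrite mxE.
Qed.

Lemma is_derive_scalemx {m n} (f : V -> R) (A : V -> 'M[R]_(m, n)) x v df dA :
  is_derive x v f df -> is_derive x v A dA ->
  is_derive x v (fun y => f y *: A y) (df *: A x + f x *: dA).
Proof.
move=> fx /is_derive_mxP Ax; apply/is_derive_mxP => i j.
apply: is_derive_ext (is_deriveM fx (Ax i j)) => [y|]; rewrite !mxE//.
by rewrite addrC /GRing.scale/= (mulrC (A x i j)).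
Qed.

End MatrixDerivative.

Lemma derive_line {R : realType} {V W : normedModType R} (f : V -> W) x v :
  'D_v f x = 'D_(1 : R) (fun r : R => f (r *: v + x)) 0.
Proof.
rewrite /derive; set g1 := fun h => h^-1 *: _; set g2 := fun h => h^-1 *: _.
suff -> : g1 = g2 by [].
by rewrite funeqE /g1 /g2 => h /=; rewrite addr0 scale0r add0r [_%:A]mulr1.
Qed.

Section Chain.
Context {R : realType} {V W U : normedModType R}.

(** Only the outer function has to be Frechet differentiable: the inner one is
    restricted to the line through [x] in the direction [v], where derivability
    and differentiability agree. This covers both changes of coordinates and
    curves. *)
Lemma is_derive_comp (f : W -> U) (g : V -> W) x v dg :
  differentiable f (g x) -> is_derive x v g dg ->
  is_derive x v (f \o g) ('D_dg f (g x)).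
Proof.
move=> fd [gx gv].
pose c := fun r : R => g (r *: v + x).
have cE : c 0 = g x by rewrite /c scale0r add0r.
have cd : derivable c 0 1.
  exact ((derivable1P _ _ _).1 gx).
have cv : 'D_1 c 0 = dg by rewrite -gv [RHS]derive_line.
have cdf : differentiable c 0 by move/derivable1_diffP : cd.
have fcd : differentiable (f \o c) 0.
  by apply: differentiable_comp => //; rewrite cE.
apply: DeriveDef.
  apply: (derivable1P _ _ _).2; exact: (derivable1_diffP _ _).2 fcd.
rewrite derive_line.
rewrite -[LHS]/('D_1 (f \o c) 0).
rewrite (deriveE _ fcd).
rewrite diff_comp; last first.
  by rewrite cE.
  by [].
rewrite /=.
by rewrite -(deriveE _ cdf) cv cE deriveE.
Qed.

End Chain.

Lemma deriveE_pderiv {R : realType} {n} (f : 'rV[R]_n -> R) x v :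
  differentiable f x -> 'D_v f x = \sum_(a < n) v 0 a * pderiv a f x.
Proof.
move=> fd; rewrite deriveE// {1}(row_sum_delta v) linear_sum/=.
by apply: eq_bigr => a _; rewrite linearZ/= /pderiv deriveE.
Qed.

Section DifferentiableClosure.
Context {R : realType} {V : normedModType R}.

Lemma differentiable_bigsum {I} (s : seq I) (P : pred I) (f : I -> V -> R) x :
  (forall i, differentiable (f i) x) ->
  differentiable (fun y => \sum_(i <- s | P i) f i y) x.
Proof.
move=> fd; elim: s => [|i s IH].
  by under eq_fun do rewrite big_nil; exact: differentiable_cst.
under eq_fun do rewrite big_cons.
by case: (P i) => //; apply: differentiableD.
Qed.

Lemma differentiable_bigprod {I} (s : seq I) (P : pred I) (f : I -> V -> R) x :
  (forall i, differentiable (f i) x) ->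
  differentiable (fun y => \prod_(i <- s | P i) f i y) x.
Proof.
move=> fd; elim: s => [|i s IH].
  by under eq_fun do rewrite big_nil; exact: differentiable_cst.
under eq_fun do rewrite big_cons.
by case: (P i) => //; apply: differentiableM.
Qed.

Lemma differentiable_det {n} (A : V -> 'M[R]_n) x :
  (forall i j, differentiable (fun y => A y i j) x) ->
  differentiable (fun y => \det (A y)) x.
Proof.
move=> Ad; apply: differentiable_bigsum => s.
apply: differentiableM; first exact: differentiable_cst.
exact: differentiable_bigprod.
Qed.

(** Differentiability is a statement about a remainder near [x], so that it
    survives a change of the function away from [x]. *)
Lemma differentiable_near_eq {W : normedModType R} (f g : V -> W) x :
  (\near x, f x = g x) -> differentiable f x -> differentiable g x.
Proof.
move=> fg fd; apply/diffP => /=.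
apply: (@getPex _ (fun (df : {linear V -> W}) => continuous df /\
  forall y, g y = g (lim (nbhs x)) + df (y - lim (nbhs x))
                  +o_(y \near x) (y - lim (nbhs x)))).
exists ('d f x); split; first exact: diff_continuous.
have /eqaddoP fo : f = (fun y => f (lim (nbhs x)) + 'd f x (y - lim (nbhs x)))
    +o_ x (fun y => y - lim (nbhs x)).
  by rewrite funeqE; exact: diffE.
suff go : g = (fun y => g (lim (nbhs x)) + 'd f x (y - lim (nbhs x)))
    +o_ x (fun y => y - lim (nbhs x)) by move=> y; rewrite [LHS](congr1 (@^~ y) go).
apply: (eqaddoP _ _ _ _).2 => e e0.
have fgx : f (lim (nbhs x)) = g (lim (nbhs x)).
  by rewrite lim_id//; exact: nbhs_singleton fg.
by apply: filterS2 fg (fo e e0) => y fgy; rewrite -fgx !fctE -fgy.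
Qed.

(** By Cramer's rule the entries of the inverse are rational functions of the
    entries of the matrix. *)
Lemma differentiable_invmx {n} (A : V -> 'M[R]_n) x :
  (\near x, A x \in unitmx) ->
  (forall i j, differentiable (fun y => A y i j) x) ->
  forall i j, differentiable (fun y => invmx (A y) i j) x.
Proof.
move=> Au Ad i j.
apply: (@differentiable_near_eq _ (fun y => (\det (A y))^-1 * \adj (A y) i j)).
  by apply: filterS Au => y Ay; rewrite /invmx Ay [RHS]mxE.
have xu : A x \in unitmx by exact: nbhs_singleton Au.
apply: differentiableM.
  apply: differentiableV; first exact: differentiable_det.
  by rewrite -unitfE -unitmxE.
under eq_fun do rewrite mxE /cofactor.
apply: differentiableM; first exact: differentiable_cst.
apply: differentiable_det => k l.
by under eq_fun do rewrite !mxE.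
Qed.

End DifferentiableClosure.

(** * Symmetry of second derivatives *)

Section Schwarz.
Context {R : realType} {V : normedModType R}.
Implicit Types (f : V -> R) (x v w : V).

Lemma differentiable_expansion f x : differentiable f x -> forall e, 0 < e ->
  exists2 d, 0 < d & forall k, `|k| < d ->
    `|f (k + x) - f x - 'd f x k| <= e * `|k|.
Proof.
move=> /diff_locally /eqaddoP fo e e0.
have /nbhs_norm0P[d d0 H] := fo e e0.
exists d => // k /H; rewrite !fctE/=; by rewrite opprD addrA.
Qed.

(** The mean value theorem applied to
    [r |-> f (r v + s w + x) - f (r v + x)] turns the second difference into
    [s] times an increment of ['D_v f] between two points at distance [O(s)]
    from [x]; differentiability of ['D_v f] at [x] evaluates that increment up
    to [o(s)]. *)
Lemma second_difference f x v w :
  (\near x, differentiable f x) -> differentiable (fun y => 'D_v f y) x ->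
  forall e, 0 < e -> \forall s \near 0^'+,
    `|f (s *: v + (s *: w + x)) - f (s *: v + x) - f (s *: w + x) + f x
      - s ^+ 2 * 'D_w (fun y => 'D_v f y) x| <= e * s ^+ 2.
Proof.
move=> fd pd e e0.
(* [s K] dominates the sum of the norms of the displacements [c v + s w] and
   [c v], where [c <= s]; the summand [1] makes [K] positive. *)
pose K := 2 * `|v| + `|w| + 1.
have K0 : 0 < K by rewrite /K; have := normr_ge0 v; have := normr_ge0 w; lra.
have [d d0 Hd] := differentiable_expansion pd (divr_gt0 e0 K0).
have [d' d'0 fd'] : exists2 d', 0 < d' & forall k, `|k| < d' -> differentiable f (k + x).
  have : \forall k \near 0, differentiable f (k + x).
    by move: fd; rewrite (near_shift 0 x); apply: filterS => k /=; rewrite subr0.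
  by move=> /nbhs_norm0P.
pose m := Num.min d d' / K.
have m0 : 0 < m by rewrite divr_gt0// lt_min d0.
near=> s.
have s0 : 0 < s by [].
have sm : s < m by near: s; exact: nbhs_right_lt.
have small a b : 0 <= a -> a <= s -> 0 <= b -> b <= s ->
    `|a *: v + b *: w| < d /\ `|a *: v + b *: w| < d'.
  move=> a0 as_ b0 bs.
  have : `|a *: v + b *: w| < Num.min d d'; last by rewrite lt_min => /andP.
  apply: (@le_lt_trans _ _ (s * K)); last by rewrite -ltr_pdivlMr.
  rewrite (le_trans (ler_normD _ _))// !normrZ ger0_norm// ger0_norm//.
  have := ler_wpM2r (normr_ge0 v) as_; have := ler_wpM2r (normr_ge0 w) bs.
  have := mulr_ge0 (ltW s0) (normr_ge0 v).
  rewrite /K; nra.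
pose g r := f (r *: v + (s *: w + x)) - f (r *: v + x).
pose dg r := 'D_v f (r *: v + (s *: w + x)) - 'D_v f (r *: v + x).
have line y r : is_derive (r : R) (1 : R) (fun r : R => r *: v + y) v.
  have lv : is_derive r (1 : R) (fun r : R => r *: v) v.
    apply: DeriveDef; first exact/diff_derivable.
    by rewrite deriveE// diff_val scale1r.
  by apply: is_derive_eq; rewrite addr0.
have gd r : 0 <= r -> r <= s -> is_derive r 1 g (dg r).
  move=> r0 rs.
  apply: is_deriveB.
    apply: is_derive_comp (line _ _); rewrite addrA; apply fd'.
    exact: (small _ _ r0 rs (ltW s0) (lexx s)).2.
  apply: is_derive_comp (line _ _); apply fd'.
  have := (small _ 0 r0 rs (lexx 0) (ltW s0)).2; by rewrite scale0r addr0.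
have [c cs gE] : exists2 c, c \in `]0, s[%R & g s - g 0 = dg c * (s - 0).
  apply: MVT => //.
    by move=> r; rewrite in_itv/= => /andP[r0 rs]; apply: gd; exact: ltW.
  apply: derivable_within_continuous => r; rewrite in_itv/= => /andP[r0 rs].
  by case: (gd _ r0 rs).
move: cs; rewrite in_itv/= => /andP[/ltW c0 /ltW cs].
have -> : f (s *: v + (s *: w + x)) - f (s *: v + x) - f (s *: w + x) + f x
   = s * dg c.
  move: gE; rewrite subr0 mulrC => <-; rewrite /g !scale0r !add0r; ring.
have A1 := Hd _ (small _ _ c0 cs (ltW s0) (lexx s)).1.
have A2 := Hd _ (small _ _ c0 cs (lexx 0) (ltW s0)).1.
have Lw : 'd ('D_v f) x (c *: v + s *: w) - 'd ('D_v f) x (c *: v + 0 *: w)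
    = s * 'D_w ('D_v f) x.
  by rewrite deriveE// scale0r addr0 linearD addrC addKr linearZ.
have N1 : `|c *: v + s *: w| <= s * `|v| + s * `|w|.
  rewrite (le_trans (ler_normD _ _))// !normrZ (ger0_norm c0) gtr0_norm//.
  by rewrite lerD2r ler_wpM2r.
have N2 : `|c *: v + 0 *: w| <= s * `|v|.
  by rewrite scale0r addr0 normrZ (ger0_norm c0) ler_wpM2r.
have -> : s * dg c - s ^+ 2 * 'D_w ('D_v f) x = s * (dg c - s * 'D_w ('D_v f) x).
  by ring.
rewrite normrM gtr0_norm// mulrC exprS expr1 mulrA ler_wpM2r//.
rewrite -Lw /dg.
have eK : 0 < e / K by rewrite divr_gt0.
have -> : e * s = e / K * (s * K) by field; rewrite gt_eqF.
move: A1 A2; set h1 := c *: v + s *: w; set h2 := c *: v + 0 *: w => A1 A2.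
have -> : c *: v + (s *: w + x) = h1 + x by rewrite /h1 addrA.
have -> : c *: v + x = h2 + x by rewrite /h2 scale0r addr0.
have -> : 'D_v f (h1 + x) - 'D_v f (h2 + x) - ('d ('D_v f) x h1 - 'd ('D_v f) x h2)
   = ('D_v f (h1 + x) - 'D_v f x - 'd ('D_v f) x h1)
     - ('D_v f (h2 + x) - 'D_v f x - 'd ('D_v f) x h2) by ring.
rewrite (le_trans (ler_normB _ _))// (le_trans (lerD A1 A2))//.
rewrite -mulrDr ler_wpM2l//; first exact: ltW.
rewrite (le_trans (lerD N1 N2))// /K; lra.
Unshelve. all: by end_near. Qed.

(** The second difference is symmetric in [v] and [w], and divided by [s ^+ 2]
    it converges to either of the two mixed derivatives. *)
Lemma derive_comm f x v w :
  (\near x, differentiable f x) ->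
  differentiable ('D_v f) x -> differentiable ('D_w f) x ->
  'D_v ('D_w f) x = 'D_w ('D_v f) x.
Proof.
move=> fd vd wd; apply/eqP; rewrite -subr_eq0 -normr_le0.
apply/ler_addgt0Pr => e e0; rewrite add0r.
have e2 : 0 < e / 2 by rewrite divr_gt0.
have Nv := second_difference w fd vd e2.
have Nw := second_difference v fd wd e2.
have [s [[Av Aw] s0]] := filter_ex (filterI (filterI Nv Nw) (nbhs_right_gt 0)).
rewrite -(ler_pM2l (exprn_gt0 2 s0)) -{1}(gtr0_norm (exprn_gt0 2 s0)) -normrM.
have -> : s ^+ 2 * e = e / 2 * s ^+ 2 + e / 2 * s ^+ 2 by field.
apply: le_trans (lerD Av Aw); rewrite (le_trans _ (ler_normB _ _))//.
move: Av Aw; rewrite (addrCA (s *: w)).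
move: (f _) (f _) (f _) ('D_w _ _ : R) ('D_v _ _ : R) => a b c p q.
move=> _ _; rewrite le_eqVlt; apply/orP; left; apply/eqP; congr (`|_|); ring.
Qed.
End Schwarz.

(** * The Levi-Civita connection in a chart, in matrix form *)

Section ChartGeometry.
Context {R : realType} {n : nat} {N : smoothManifold R n}.
Context (h : riemannianMetric N) (i : chart_index N).
Implicit Types x X Y Z : 'rV[R]_n.

Lemma near_cimage x : cimage (atlas i) x -> \near x, cimage (atlas i) x.
Proof. by move=> ix; apply: open_nbhs_nbhs; split=> //; exact: cimage_open. Qed.

Lemma differentiable_hmx a b x : cimage (atlas i) x ->
  differentiable (fun y => hmx h i y a b) x.
Proof. by move=> ix; exact: (hmx_smooth h a b [::]). Qed.

Lemma differentiable_pderiv_hmx c a b x : cimage (atlas i) x ->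
  differentiable (pderiv c (fun y => hmx h i y a b)) x.
Proof. by move=> ix; exact: (hmx_smooth h a b [:: c]). Qed.

Lemma differentiable_christoffel k a b x : cimage (atlas i) x ->
  differentiable (christoffel h i k a b) x.
Proof.
move=> ix; apply: differentiableM; first exact: differentiable_cst.
apply: differentiable_bigsum => l; apply: differentiableM.
  apply: differentiable_invmx; last by move=> ? ?; exact: differentiable_hmx.
  by apply: filterS (near_cimage ix) => y; exact: hmx_unitmx.
apply: differentiableB; last exact: differentiable_pderiv_hmx.
by apply: differentiableD; exact: differentiable_pderiv_hmx.
Qed.

(** The connection matrix: tangent vectors are row vectors, and for a field [Z]
    one has nabla_X Z = 'D_X Z + Z *m connection_mx X. *)
Definition connection_mx X x : 'M[R]_n :=
  \matrix_(b, k) \sum_(a < n) christoffel h i k a b x * X 0 a.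

Definition dconnection_mx X Y x : 'M[R]_n :=
  \matrix_(b, k) \sum_(a < n) 'D_X (christoffel h i k a b) x * Y 0 a.

Local Notation G := connection_mx.
Local Notation dG := dconnection_mx.
Local Notation H := (hmx h i).

(** Absence of torsion. *)
Lemma connection_mxC X Y x : cimage (atlas i) x ->
  Y *m G X x = X *m G Y x.
Proof.
move=> ix; apply/rowP => k; rewrite !mxE.
under eq_bigr do rewrite mxE mulr_sumr.
rewrite exchange_big/=; apply: eq_bigr => a _; rewrite mxE mulr_sumr.
by apply: eq_bigr => b _; rewrite (christoffelC h k a b ix); ring.
Qed.

(** Metric compatibility of the connection. *)
Lemma is_derive_hmx X x : cimage (atlas i) x ->
  is_derive x X H (G X x *m H x + H x *m (G X x)^T).
Proof.
move=> ix; apply/is_derive_mxP => a b.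
have fd := differentiable_hmx a b ix.
apply: DeriveDef; first exact: diff_derivable.
rewrite deriveE_pderiv//.
under eq_bigr do rewrite christoffel_metric// mulr_sumr.
rewrite exchange_big/= !mxE -big_split/=; apply: eq_bigr => k _.
rewrite !mxE mulr_suml mulr_sumr -big_split/=; apply: eq_bigr => c _; ring.
Qed.

Lemma is_derive_connection_mx X Y x : cimage (atlas i) x ->
  is_derive x X (G Y) (dG X Y x).
Proof.
move=> ix; apply/is_derive_mxP => b k.
have Gd a : is_derive x X (christoffel h i k a b) ('D_X (christoffel h i k a b) x).
  by apply/derivableP/diff_derivable; exact: differentiable_christoffel.
have := is_derive_sum (fun a => is_deriveM (Gd a) (is_derive_cst (Y 0 a) x X)).
apply: is_derive_ext => [y|]; first by rewrite mxE fct_sumE.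
by rewrite mxE; apply: eq_bigr => a _; rewrite scaler0 add0r mulrC.
Qed.

Lemma hmx_derive_comm X Y a b x : cimage (atlas i) x ->
  'D_X ('D_Y (fun y => H y a b)) x = 'D_Y ('D_X (fun y => H y a b)) x.
Proof.
move=> ix.
have fd : \near x, differentiable (fun y => H y a b) x.
  by apply: filterS (near_cimage ix) => y; exact: differentiable_hmx.
have dd Z : differentiable ('D_Z (fun y => H y a b)) x.
  apply: (@differentiable_near_eq _ _ _
    (fun y => \sum_(c < n) Z 0 c * pderiv c (fun y => H y a b) y)).
    by apply: filterS fd => y yd; rewrite deriveE_pderiv.
  apply: differentiable_bigsum => c; apply: differentiableM.
    exact: differentiable_cst.
  exact: differentiable_pderiv_hmx.
exact: derive_comm.
Qed.

(** The curvature operator Z |-> R(X, Y)Z, for constant coordinate fields X and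
    Y; the products appear in the order opposite to the usual one because
    matrices act on row vectors from the right. *)
Definition curvature_mx X Y x : 'M[R]_n :=
  dG X Y x - dG Y X x + G Y x *m G X x - G X x *m G Y x.

Lemma riemannE X Y Z x : cimage (atlas i) x ->
  riemann h i x X Y Z = Z *m curvature_mx X Y x.
Proof.
move=> ix.
have dGE U W c k : dG U W x c k = \sum_(a < n) \sum_(b < n)
    pderiv a (christoffel h i k b c) x * U 0 a * W 0 b.
  rewrite mxE exchange_big/=; apply: eq_bigr => b _.
  rewrite deriveE_pderiv; last exact: differentiable_christoffel.
  by rewrite mulr_suml; apply: eq_bigr => a _; ring.
have GGE U W c k : (G U x *m G W x) c k = \sum_(a < n) \sum_(b < n)
    (\sum_(l < n) christoffel h i l b c x * christoffel h i k a l x)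
      * W 0 a * U 0 b.
  rewrite mxE.
  under eq_bigr do rewrite !mxE mulr_suml.
  under eq_bigr do under eq_bigr do rewrite mulr_sumr.
  rewrite exchange_big/= [RHS]exchange_big/=; apply: eq_bigr => b _.
  rewrite exchange_big/=; apply: eq_bigr => a _.
  by rewrite !mulr_suml; apply: eq_bigr => l _; ring.
have swap (F : 'I_n -> 'I_n -> R) :
  \sum_(a < n) \sum_(b < n) F a b = \sum_(a < n) \sum_(b < n) F b a.
  exact: exchange_big.
have KE c k : curvature_mx X Y x c k = \sum_(a < n) \sum_(b < n)
    riemann_coef h i k a b c x * X 0 a * Y 0 b.
  rewrite /curvature_mx mxE [X in X + _]mxE [X in X + _ + _]mxE.
  rewrite [X in _ + X + _ + _]mxE [X in _ + X]mxE !dGE !GGE.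
  rewrite (swap (fun a b : 'I_n =>
    pderiv a (christoffel h i k b c) x * Y 0 a * X 0 b))/=.
  rewrite (swap (fun a b : 'I_n =>
    (\sum_(l < n) christoffel h i l b c x * christoffel h i k a l x)
      * Y 0 a * X 0 b))/=.
  rewrite -!sumrN -!big_split/=; apply: eq_bigr => a _.
  rewrite -!sumrN -!big_split/=; apply: eq_bigr => b _.
  rewrite /riemann_coef big_split/= sumrN.
  move: (pderiv _ _ _) (pderiv _ _ _) (\sum_(l < n) _) (\sum_(l < n) _).
  by move=> p q r s; ring.
apply/rowP => k; rewrite !mxE.
under [RHS]eq_bigr do rewrite KE mulr_sumr.
rewrite [RHS]exchange_big/=; apply: eq_bigr => a _.
under [RHS]eq_bigr do rewrite mulr_sumr.
rewrite [RHS]exchange_big/=; apply: eq_bigr => b _.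
apply: eq_bigr => c _; ring.
Qed.

(** Differentiating metric compatibility once more expresses ['D_X 'D_Y H]
    through the connection. Antisymmetrizing in [X] and [Y], the left-hand side
    vanishes by symmetry of second derivatives and the right-hand side is
    K H + (K H)^T for the curvature operator K. *)
Lemma curvature_mx_skew X Y x : cimage (atlas i) x ->
  (curvature_mx X Y x *m H x)^T = - (curvature_mx X Y x *m H x).
Proof.
move=> ix.
have second U W : \matrix_(a, b) 'D_U ('D_W (fun y => H y a b)) x =
    dG U W x *m H x + G W x *m (G U x *m H x + H x *m (G U x)^T) +
    ((G U x *m H x + H x *m (G U x)^T) *m (G W x)^T + H x *m (dG U W x)^T).
  have dGd := is_derive_connection_mx U W ix.
  have dHd := is_derive_hmx U ix.
  have [Pd PE] := is_deriveD (is_derive_mulmx dGd dHd)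
    (is_derive_mulmx dHd (is_derive_trmx dGd)).
  rewrite -PE derive_mx//.
  apply/matrixP => a b; rewrite !mxE; apply: near_eq_derive.
  apply: filterS (near_cimage ix) => y iy.
  have /is_derive_mxP/(_ a b)[_ ->] := is_derive_hmx W iy.
  by rewrite mxE.
have mixed : \matrix_(a, b) 'D_X ('D_Y (fun y => H y a b)) x =
       \matrix_(a, b) 'D_Y ('D_X (fun y => H y a b)) x.
  apply/matrixP => a b; rewrite [LHS]mxE [RHS]mxE.
  exact: (hmx_derive_comm X Y a b ix).
have {second mixed} := etrans (esym (second X Y)) (etrans mixed (second Y X)).
rewrite /curvature_mx.
rewrite trmx_mul hmx_sym//.
move: (dG X Y x) (dG Y X x) (G X x) (G Y x) (H x) => dXY dYX gX gY K.
rewrite !linearD/= !linearN/= !trmx_mul.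
rewrite !(mulmxDr, mulmxDl, mulmxN, mulNmx, mulmxA).
move=> /matrixP E; apply/matrixP => a b; move: (E a b).
rewrite !(addmx_entry, oppmx_entry); lra.
Qed.

Lemma riemann_orthogonal X Y Z x : cimage (atlas i) x ->
  inner (H x) (riemann h i x X Y Z) Z = 0.
Proof.
move=> ix; rewrite riemannE// /inner -(mulmxA Z).
move: (curvature_mx_skew X Y ix); move: (curvature_mx X Y x *m H x) => K KT.
have : (Z *m K *m Z^T)^T = - (Z *m K *m Z^T).
  by rewrite !trmx_mul trmxK KT mulNmx mulmxN mulmxA.
by move=> /matrixP/(_ 0 0); rewrite [LHS]mxE [RHS]mxE; lra.
Qed.

End ChartGeometry.

(** * Sections along a curve, in a chart *)

Section Inner.
Context {R : realType} {n : nat} (H : 'M[R]_n).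
Implicit Types v w : 'rV[R]_n.

Lemma innerDl v1 v2 w : inner H (v1 + v2) w = inner H v1 w + inner H v2 w.
Proof. by rewrite /inner !mulmxDl mxE. Qed.

Lemma innerZl a v w : inner H (a *: v) w = a * inner H v w.
Proof. by rewrite /inner -!scalemxAl mxE. Qed.

Lemma inner0l w : inner H 0 w = 0.
Proof. by rewrite /inner !mul0mx mxE. Qed.

Lemma inner0r v : inner H v 0 = 0.
Proof. by rewrite /inner trmx0 mulmx0 mxE. Qed.

Lemma innerC v w : H^T = H -> inner H v w = inner H w v.
Proof.
move=> HT; rewrite /inner.
have -> : v *m H *m w^T = (w *m H *m v^T)^T by rewrite !trmx_mul trmxK HT mulmxA.
by rewrite mxE.
Qed.

Lemma inner_ge0 v : (forall w, w != 0 -> 0 < inner H w w) -> 0 <= inner H v v.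
Proof.
move=> Hp; have [->|/Hp/ltW//] := eqVneq v 0.
by rewrite inner0l.
Qed.

Lemma inner_eq0 v : (forall w, w != 0 -> 0 < inner H w w) ->
  inner H v v = 0 -> v = 0.
Proof.
by move=> Hp v0; apply/eqP/negPn/negP => /Hp; rewrite v0 ltxx.
Qed.

Lemma cauchy_schwarz v w : H^T = H -> (forall w, w != 0 -> 0 < inner H w w) ->
  `|inner H v w| <= Num.sqrt (inner H v v) * Num.sqrt (inner H w w).
Proof.
move=> HT Hp.
have [a0 b0] := (inner_ge0 v Hp, inner_ge0 w Hp).
(* The quadratic form at <w, w> v - <v, w> w is <w, w> times the discriminant. *)
have disc : inner H v w ^+ 2 <= inner H v v * inner H w w.
  have [w0|w0] := eqVneq w 0.
    by rewrite w0 !inner0r expr0n/= mulr0.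
  have := inner_ge0 (inner H w w *: v + (- inner H v w) *: w) Hp.
  rewrite innerDl !innerZl (innerC v _ HT) (innerC w _ HT) !innerDl !innerZl.
  rewrite (innerC w v HT).
  have -> : inner H w w * (inner H w w * inner H v v + - inner H v w * inner H v w)
     + - inner H v w * (inner H w w * inner H v w + - inner H v w * inner H w w) =
    inner H w w * (inner H v v * inner H w w - inner H v w ^+ 2) by ring.
  by rewrite pmulr_rge0 ?Hp// subr_ge0.
by rewrite -sqrtrM// -sqrtr_sqr ler_wsqrtr.
Qed.

End Inner.

Section ChartCurve.
Context {R : realType} {n : nat} {N : smoothManifold R n}.
Context (h : riemannianMetric N) (u : R -> N) (i : chart_index N).
Hypothesis su : smooth_curve u.
Implicit Types (V W : R -> 'rV[R]_n) (t : R).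

Local Notation c := (Defs.coord u i).
Local Notation T := (velocity u i).
Local Notation H := (hmx h i).
Local Notation G := (connection_mx h i).
Local Notation D := (cov h u i).
Local Notation dom t := (cdom (atlas i) (u t)).

(** The value is independent of the chart when the components of the sections
    transform by the Jacobian of the change of charts, see
    [section_inner_transition]. *)
Definition section_inner V W t : R := inner (H (c t)) (V t) (W t).

Lemma section_inner_eq0l V W t : V t = 0 -> section_inner V W t = 0.
Proof. by move=> V0; rewrite /section_inner V0 inner0l. Qed.

Lemma section_inner_eq0r V W t : W t = 0 -> section_inner V W t = 0.
Proof. by move=> W0; rewrite /section_inner W0 inner0r. Qed.

Lemma near_cdom t : dom t -> \near t, dom t.
Proof.
move=> it; apply: (su.1 t); apply: open_nbhs_nbhs; split=> //.
exact: cdom_open.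
Qed.

Lemma coord_cimage t : dom t -> cimage (atlas i) (c t).
Proof. by move=> it; exists (u t). Qed.

Lemma is_derive_coord t : dom t -> is_derive t 1 c (T t).
Proof.
move=> it; apply: DeriveDef; first exact: (su.2 i 0%N t it).
by rewrite /velocity derive1E.
Qed.

Lemma derivable_velocity t : dom t -> derivable T t 1.
Proof. by move=> it; exact: (su.2 i 1%N t it). Qed.

Lemma derivable_acceleration t : dom t -> derivable (derive1 T) t 1.
Proof. by move=> it; exact: (su.2 i 2 t it). Qed.

Lemma covE V t : D V t = derive1 V t + V t *m G (T t) (c t).
Proof.
congr (_ + _); apply/rowP => k; rewrite !mxE exchange_big/=.
apply: eq_bigr => b _; rewrite mxE mulr_sumr.
by apply: eq_bigr => a _; rewrite mulrC.
Qed.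

Lemma is_derive_cov V t : derivable V t 1 ->
  is_derive t 1 V (D V t - V t *m G (T t) (c t)).
Proof.
by move=> Vt; apply: DeriveDef => //; rewrite covE addrK derive1E.
Qed.

Lemma is_derive_hmx_coord t : dom t ->
  is_derive t 1 (fun s => H (c s))
    (G (T t) (c t) *m H (c t) + H (c t) *m (G (T t) (c t))^T).
Proof.
move=> it; have ix := coord_cimage it; apply/is_derive_mxP => a b.
have := is_derive_comp (differentiable_hmx h a b ix) (is_derive_coord it).
by have /is_derive_mxP/(_ a b)[_ ->] := is_derive_hmx h (T t) ix.
Qed.

(** The product rule for the metric. The derivative of the Gram matrix along the
    curve contributes exactly the connection terms of the two covariant
    derivatives. *)
Lemma is_derive_section_inner V W t : dom t ->
  derivable V t 1 -> derivable W t 1 ->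
  is_derive t 1 (section_inner V W)
    (section_inner (D V) W t + section_inner V (D W) t).
Proof.
move=> it /is_derive_cov Vd /is_derive_cov Wd.
have := is_derive_mulmx (is_derive_mulmx Vd (is_derive_hmx_coord it))
  (is_derive_trmx Wd).
move=> /is_derive_mxP/(_ 0 0); apply: is_derive_ext => [//|].
rewrite /section_inner /inner; set A := G _ _; set K := H _.
rewrite linearB/= trmx_mul.
rewrite !(mulmxDr, mulmxDl, mulmxN, mulNmx, mulmxA).
rewrite !(addmx_entry, oppmx_entry); lra.
Qed.

Lemma derivable_tension t : dom t -> derivable (tension h u i) t 1.
Proof.
move=> it; have ix := coord_cimage it.
have Gd : derivable (fun s => G (T s) (c s)) t 1.
  apply/derivable_mxP => b k; under eq_fun do rewrite mxE.
  have Ed a : derivable (fun s => christoffel h i k a b (c s) * T s 0 a) t 1.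
    apply: derivableM.
      by have [] := is_derive_comp (differentiable_christoffel h k a b ix)
        (is_derive_coord it).
    exact: (derivable_mxP _ _ _).1 (derivable_velocity it) _ _.
  by apply: derivable_ext (derivable_sum Ed) => s; rewrite fct_sumE.
have [+ _] := (is_deriveD (derivableP (derivable_acceleration it))
  (is_derive_mulmx (derivableP (derivable_velocity it)) (derivableP Gd))).
by apply: derivable_ext => s; rewrite /tension covE.
Qed.

Lemma section_inner_ge0 V t : dom t -> 0 <= section_inner V V t.
Proof.
by move=> it; apply: inner_ge0 => v; exact/hmx_pos/coord_cimage.
Qed.

Lemma section_innerC V W t : dom t -> section_inner V W t = section_inner W V t.
Proof. by move=> it; exact/innerC/hmx_sym/coord_cimage. Qed.

Lemma sqr_sec_norm V t : dom t -> sec_norm h u i V t ^+ 2 = section_inner V V t.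
Proof. by move=> it; rewrite sqr_sqrtr//; exact: section_inner_ge0. Qed.

End ChartCurve.

(** * The first integral of the p-biharmonic equation *)

Section ChartConservation.
Context {R : realType} {n : nat} {N : smoothManifold R n}.
Context (h : riemannianMetric N) (u : R -> N) (i : chart_index N).
Context (p : R) (p2 : 2 <= p) (su : smooth_curve u).
Implicit Types (V W : R -> 'rV[R]_n) (t : R).

Local Notation c := (Defs.coord u i).
Local Notation T := (velocity u i).
Local Notation H := (hmx h i).
Local Notation D := (cov h u i).
Local Notation dom t := (cdom (atlas i) (u t)).
Local Notation tau := (tension h u i).
Local Notation sinner := (section_inner h u i).
Local Notation ptau := (ptension h u i p).

Lemma sec_norm_eq0 V t : dom t -> sec_norm h u i V t = 0 -> V t = 0.
Proof.
move=> it V0; apply: (@inner_eq0 _ _ (H (c t))).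
  by move=> w; exact/hmx_pos/coord_cimage.
by rewrite -/(section_inner h u i V V t) -sqr_sec_norm// V0 expr0n.
Qed.

Lemma powR_sub2_sqr (a : R) : 0 <= a -> a `^ (p - 2) * a ^+ 2 = a `^ p.
Proof.
rewrite le_eqVlt => /predU1P[<-|a0].
  by rewrite expr0n/= mulr0 powR0// gt_eqF//; move: p2; lra.
rewrite -powR_mulrn ?(ltW a0)// -powRD; last by rewrite (gt_eqF a0) implybT.
by rewrite subrK.
Qed.

Lemma ptension_tension t : dom t -> sinner ptau tau t = sec_norm h u i tau t `^ p.
Proof.
move=> it; rewrite -powR_sub2_sqr ?sqrtr_ge0// sqr_sec_norm//.
by rewrite /section_inner innerZl.
Qed.

Lemma cov_scale (f : R -> R) V t df : dom t -> is_derive t 1 f df ->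
  derivable V t 1 -> D (fun s => f s *: V s) t = df *: V t + f t *: D V t.
Proof.
move=> it fd Vd; rewrite !covE scalerDr addrA scalemxAl; congr (_ + _).
have [_ E] := is_derive_scalemx fd (derivableP Vd).
by rewrite derive1E E derive1E.
Qed.

(** Where tau does not vanish, |tau|^(p-2) is differentiable with derivative
    (p-2) |tau|^(p-4) <tau, D tau>. Where tau vanishes so does |tau|^(p-2) tau,
    and both sides are 0. *)
Lemma cov_ptension t : dom t -> derivable ptau t 1 ->
  sinner (D ptau) tau t = (p - 1) * sinner ptau (D tau) t.
Proof.
move=> it pd.
have [/(sec_norm_eq0 it) t0|tn0] := eqVneq (sec_norm h u i tau t) 0.
  have pt0 : ptau t = 0 by rewrite /ptension t0 scaler0.
  by rewrite (section_inner_eq0r h u i _ t0) (section_inner_eq0l h u i _ pt0) mulr0.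
have a0 : 0 < sec_norm h u i tau t by rewrite lt_neqAle eq_sym tn0 sqrtr_ge0.
have q0 : 0 < sinner tau tau t by rewrite -sqr_sec_norm// exprn_gt0.
have td := derivable_tension (h:=h) su it.
have qd := is_derive_section_inner h su it td td.
have sd := is_derive1_comp (is_derive1_sqrt q0) qd.
have fd := is_derive1_comp (is_derive1_powR (p - 2) a0) sd.
rewrite /section_inner (cov_scale it fd td) innerDl !innerZl.
rewrite -/(sinner tau tau t) -/(sinner tau (D tau) t) -/(sinner (D tau) tau t).
rewrite (section_innerC h (D tau) tau it) -(sqr_sec_norm h tau it).
rewrite [(_ \o _) t]/=; move: a0.
set a := sec_norm h u i tau t => a0; rewrite sqrtr_sqr (gtr0_norm a0).
have -> : a `^ (p - 2) = a `^ (p - 2 - 1) * a.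
  by rewrite -[X in _ * X]powRr1 ?(ltW a0)// -powRD ?(gt_eqF a0) ?implybT// subrK.
by field; rewrite gt_eqF.
Qed.

Definition chart_flux t : R := sinner ptau T t.

(** The conserved quantity that corresponds to the invariance of the
    variational problem under translations of the line. *)
Definition chart_first_integral t : R :=
  sinner (D ptau) T t - (p - 1) / p * sinner ptau tau t.

(** The two parts of the derivative of the flux are <D (|tau|^(p-2) tau), T>,
    which the first integral expresses through |tau|^p, and |tau|^p itself. *)
Lemma is_derive_chart_flux t : dom t -> derivable ptau t 1 ->
  is_derive t 1 chart_flux
    (chart_first_integral t + (2 * p - 1) / p * sec_norm h u i tau t `^ p).
Proof.
move=> it pd.
have := is_derive_section_inner h su it pd (derivable_velocity su it).
apply: is_derive_ext => //; rewrite -ptension_tension// /chart_first_integral -/tau.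
by field; rewrite gt_eqF//; move: p2; lra.
Qed.

(** The equation gives D D (|tau|^(p-2) tau) = - R(|tau|^(p-2) tau, T)T, which is
    orthogonal to T by the antisymmetry of the curvature. The remaining terms are multiples
    of <|tau|^(p-2) tau, D tau> by [cov_ptension], and the coefficient
    (p - 1) / p makes them cancel. *)
Lemma is_derive_chart_first_integral t : dom t -> derivable ptau t 1 ->
  derivable (D ptau) t 1 -> pbitension h u i p t = 0 ->
  is_derive t 1 chart_first_integral 0.
Proof.
move=> it pd dpd E.
have p0 : p != 0 by rewrite gt_eqF//; move: p2; lra.
have d1 := is_derive_section_inner h su it dpd (derivable_velocity su it).
have d2 := is_derive_section_inner h su it pd (derivable_tension (h:=h) su it).
have := is_deriveB d1 (is_deriveZ ((p - 1) / p) d2).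
apply: is_derive_ext => //.
have -> : sinner (D (D ptau)) T t = 0.
  have DD : D (D ptau) t = - riemann h i (c t) (ptau t) (T t) (T t).
    apply/eqP; rewrite -addr_eq0; move: E => /eqP.
    by rewrite scaler_eq0 (negbTE p0).
  rewrite /section_inner DD -scaleN1r innerZl riemann_orthogonal ?mulr0//.
  exact: coord_cimage.
rewrite -/tau cov_ptension// /GRing.scale/=; field => //.
Qed.

(** By Cauchy-Schwarz the flux is at most |tau|^(p-1) |T|, hence at most the
    p-th power of the larger of |tau| and |T|. *)
Lemma chart_flux_le t : dom t ->
  `|chart_flux t| <= sec_norm h u i tau t `^ p + sec_norm h u i T t `^ p.
Proof.
move=> it; have ix := coord_cimage it.
rewrite /chart_flux /section_inner innerZl normrM ger0_norm ?powR_ge0//.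
have := cauchy_schwarz (tau t) (T t) (hmx_sym h ix) (fun w => @hmx_pos _ _ _ h _ _ w ix).
rewrite -/(sec_norm h u i tau t) -/(sec_norm h u i T t).
have := sqrtr_ge0 (inner (H (c t)) (tau t) (tau t)).
have := sqrtr_ge0 (inner (H (c t)) (T t) (T t)).
rewrite -/(sec_norm h u i tau t) -/(sec_norm h u i T t).
set a := sec_norm _ _ _ tau t; set b := sec_norm _ _ _ T t => b0 a0 CS.
apply: (@le_trans _ _ (a `^ (p - 2) * (a * b))).
  by rewrite ler_wpM2l ?powR_ge0.
have p20 : 0 <= p - 2 by move: p2; lra.
have p00 : 0 <= p by move: p2; lra.
have [ab|/ltW ba] := leP a b.
  rewrite (@le_trans _ _ (b `^ p)) ?ler_wpDl ?powR_ge0//.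
  rewrite -(powR_sub2_sqr b0) ler_pM ?powR_ge0 ?mulr_ge0//.
    by rewrite ge0_ler_powR ?nnegrE.
  by rewrite expr2 ler_wpM2r.
rewrite (@le_trans _ _ (a `^ p)) ?ler_wpDr ?powR_ge0//.
by rewrite -(powR_sub2_sqr a0) ler_wpM2l ?powR_ge0// expr2 ler_wpM2l.
Qed.

End ChartConservation.

(** * Change of charts *)

Lemma row_form_eq0 {R : realType} {n} (B : 'M[R]_n) :
  (forall v w : 'rV[R]_n, v *m B *m w^T = 0) -> B = 0.
Proof.
move=> B0; apply/matrixP => a b.
have /matrixP/(_ 0 0) := B0 (delta_mx 0 a) (delta_mx 0 b).
by rewrite -rowE trmx_delta -colE !mxE.
Qed.

(** Applying the antisymmetry in the outer arguments and the symmetry in the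
    first two alternately, three times each, leads back to the same value of the
    trilinear form with the opposite sign. This is the algebra behind the
    uniqueness of the Levi-Civita connection. *)
Lemma skew_symmetric_form_eq0 {R : realType} {n} (B : 'rV[R]_n -> 'M[R]_n) :
  (forall w, (B w)^T = - B w) -> (forall v w, v *m B w = w *m B v) ->
  forall w, B w = 0.
Proof.
move=> Bskew Bsym w; apply: row_form_eq0 => v z.
have b_skew (a b c : 'rV[R]_n) : a *m B b *m c^T = - (c *m B b *m a^T).
  have tr1 (M : 'M[R]_1) : M^T = M by apply/matrixP => k l; rewrite !ord1 mxE.
  by rewrite -(tr1 (a *m B b *m c^T)) !trmx_mul trmxK Bskew mulNmx mulmxN mulmxA.
have b_sym (a b c : 'rV[R]_n) : a *m B b *m c^T = b *m B a *m c^T by rewrite Bsym.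
have : v *m B w *m z^T = - (v *m B w *m z^T).
  by rewrite {1}b_skew b_sym b_skew b_sym b_skew b_sym !opprK.
move=> /matrixP E; apply/matrixP => k l; have := E k l; rewrite !mxE; lra.
Qed.

(** Here [J] stands for the Jacobian of the change of charts, [d] for its
    derivative, and [gi], [gj] for the two connection matrices: the hypothesis
    equates the derivatives of both sides of the transformation law of the
    metric. *)
Lemma metric_difference_skew {R : realType} {n} (gi gj d J K : 'M[R]_n) :
  K^T = K ->
  (d *m K + J *m (gj *m K + K *m gj^T)) *m J^T + J *m K *m d^T =
    gi *m (J *m K *m J^T) + J *m K *m J^T *m gi^T ->
  ((gi *m J - d - J *m gj) *m K *m J^T)^T
    = - ((gi *m J - d - J *m gj) *m K *m J^T).
Proof.
move=> KT; have -> : ((gi *m J - d - J *m gj) *m K *m J^T)^T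
    = J *m K *m (J^T *m gi^T - d^T - gj^T *m J^T).
  rewrite 2!trmx_mul trmxK KT mulmxA.
  by congr (_ *m _); rewrite 2!raddfB/= 2!trmx_mul.
rewrite !(mulmxDr, mulmxDl, mulmxN, mulNmx, mulmxA).
move=> /matrixP E; apply/matrixP => a b; move: (E a b).
rewrite !(addmx_entry, oppmx_entry); lra.
Qed.

Lemma differentiable_mx {R : realType} {V : normedModType R} {n}
    (f : V -> 'rV[R]_n) x :
  (forall k, differentiable (fun y => f y 0 k) x) -> differentiable f x.
Proof.
move=> fd.
have -> : f = \sum_(k < n) (fun y => f y 0 k *: delta_mx 0 k).
  by apply/funext => y; rewrite fct_sumE -row_sum_delta.
by apply: differentiable_sum => k; exact: differentiableZl.
Qed.

Section ChartChange.
Context {R : realType} {n : nat} {N : smoothManifold R n}.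
Context (h : riemannianMetric N) (i j : chart_index N).
Implicit Types (x v w : 'rV[R]_n).

Definition transition x : 'rV[R]_n := cmap (atlas j) (cinv (atlas i) x).

Definition overlap : set 'rV[R]_n :=
  cmap (atlas i) @` (cdom (atlas i) `&` cdom (atlas j)).

Definition transition_mx x : 'M[R]_n :=
  \matrix_(a, k) pderiv a (fun y => transition y 0 k) x.

Definition dtransition_mx v x : 'M[R]_n :=
  \matrix_(a, k) 'D_v (pderiv a (fun y => transition y 0 k)) x.

Local Notation J := transition_mx.
Local Notation dJ := dtransition_mx.

Lemma near_overlap x : overlap x -> \near x, overlap x.
Proof.
move=> [q [qi qj] <-].
have ci : cimage (atlas i) (cmap (atlas i) q) by exists q.
have cj : \forall y \near cmap (atlas i) q, cdom (atlas j) (cinv (atlas i) y).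
  apply: (cinv_continuous ci); rewrite cmapK//.
  by apply: open_nbhs_nbhs; split=> //; exact: cdom_open.
apply: filterS2 (near_cimage ci) cj => _ [q' q'i <-].
by rewrite cmapK// => q'j; exists q'.
Qed.

Lemma overlap_cimage x : overlap x -> cimage (atlas i) x.
Proof. by move=> [q [qi qj] <-]; exists q. Qed.

Lemma transition_cimage x : overlap x -> cimage (atlas j) (transition x).
Proof. by move=> [q [qi qj] <-]; exists q => //; rewrite /transition cmapK. Qed.

Lemma differentiable_transition_coord k x : overlap x ->
  differentiable (fun y => transition y 0 k) x.
Proof. exact: (atlas_smooth k [::]). Qed.

Lemma differentiable_pderiv_transition a k x : overlap x ->
  differentiable (pderiv a (fun y => transition y 0 k)) x.
Proof. exact: (atlas_smooth k [:: a]). Qed.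

Lemma is_derive_transition v x : overlap x ->
  is_derive x v transition (v *m J x).
Proof.
move=> ox; apply/is_derive_mxP => a k; rewrite ord1.
have kd := differentiable_transition_coord k ox.
apply: DeriveDef; first exact: diff_derivable.
rewrite deriveE_pderiv// mxE; apply: eq_bigr => b _.
by rewrite [in RHS]mxE.
Qed.

Lemma jacobian_transition x : overlap x -> jacobian transition x = J x.
Proof.
move=> ox; apply/row_matrixP => a; rewrite !rowE -deriveEjacobian.
  by have [] := is_derive_transition (delta_mx 0 a) ox.
by apply: differentiable_mx => k; exact: differentiable_transition_coord.
Qed.

Lemma hmx_transition x : overlap x ->
  hmx h i x = J x *m hmx h j (transition x) *m (J x)^T.
Proof.
move=> ox; rewrite -jacobian_transition//.
case: ox => q [qi qj] <-; rewrite {2}/transition cmapK//.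
exact: (hmx_compat h qi qj).
Qed.

Lemma is_derive_transition_mx v x : overlap x -> is_derive x v J (dJ v x).
Proof.
move=> ox; apply/is_derive_mxP => a k; rewrite mxE.
have ad := differentiable_pderiv_transition a k ox.
apply: is_derive_ext (derivableP (diff_derivable ad)) => [y|//].
by rewrite mxE.
Qed.

Lemma dtransition_mxC v w x : overlap x -> v *m dJ w x = w *m dJ v x.
Proof.
move=> ox; apply/rowP => k.
pose F y := transition y 0 k.
have expand v' w' : (v' *m dJ w' x) 0 k =
    \sum_(a < n) \sum_(b < n) v' 0 a * w' 0 b * pderiv b (pderiv a F) x.
  rewrite mxE; apply: eq_bigr => a _; rewrite [X in _ * X]mxE.
  rewrite deriveE_pderiv; last exact: differentiable_pderiv_transition.
  by rewrite mulr_sumr; apply: eq_bigr => b _; rewrite mulrA.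
have mixed a b : pderiv b (pderiv a F) x = pderiv a (pderiv b F) x.
  apply: derive_comm; [|exact: (differentiable_pderiv_transition _ _ ox)..].
  by apply: filterS (near_overlap ox) => y; exact: differentiable_transition_coord.
apply: etrans (expand v w) (etrans _ (esym (expand w v))).
apply: etrans (exchange_big _ _ _ _ _ _) _.
apply: eq_bigr => b _; apply: eq_bigr => a _.
exact: congr2 (mulrC (v 0 a) (w 0 b)) (mixed a b).
Qed.

(** Both Gram matrices are invertible, so the factors of the transformation law
    of the metric are. *)
Lemma transition_mx_unit x : overlap x -> J x \in unitmx.
Proof.
move=> ox; have := hmx_unitmx h (overlap_cimage ox).
by rewrite hmx_transition// !unitmx_mul => /andP[/andP[]].
Qed.

(** The transformation law of the Christoffel symbols. The difference of the two
    sides, with its index lowered, is antisymmetric because both connections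
    are metric, and symmetric because both are torsion free and second
    derivatives of the change of charts commute; so it vanishes. *)
Lemma connection_mx_transition w x : overlap x ->
  connection_mx h i w x *m J x =
  dJ w x + J x *m connection_mx h j (w *m J x) (transition x).
Proof.
move=> ox; have ix := overlap_cimage ox; have jx := transition_cimage ox.
pose B w := (connection_mx h i w x *m J x - dJ w x
  - J x *m connection_mx h j (w *m J x) (transition x))
  *m hmx h j (transition x) *m (J x)^T.
have B0 : B w = 0.
  apply: skew_symmetric_form_eq0 => {}w.
    have metric := is_derive_hmx h w ix.
    have chainH : is_derive x w (fun y => hmx h j (transition y))
      (connection_mx h j (w *m J x) (transition x) *m hmx h j (transition x) +
       hmx h j (transition x) *m (connection_mx h j (w *m J x) (transition x))^T).
      apply/is_derive_mxP => a b.
      have := is_derive_comp (differentiable_hmx h a b jx) (is_derive_transition w ox).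
      by have /is_derive_mxP/(_ a b)[_ ->] := is_derive_hmx h (w *m J x) jx.
    have Jd := is_derive_transition_mx w ox.
    have near_hmx : \near x, J x *m hmx h j (transition x) *m (J x)^T = hmx h i x.
      by apply: filterS (near_overlap ox) => y oy; rewrite -hmx_transition.
    have [_ other] := near_eq_is_derive near_hmx
      (is_derive_mulmx (is_derive_mulmx Jd chainH) (is_derive_trmx Jd)).
    case: metric => _; rewrite {}other.
    rewrite /B hmx_transition//.
    have HT := hmx_sym h jx.
    move: HT {B chainH near_hmx Jd}; move: (dJ w x) (hmx h j (transition x)) (J x)
      (connection_mx h i w x) (connection_mx h j _ _) => d K j0 gi gj KT.
    exact: metric_difference_skew.
  have sym v : v *m (connection_mx h i w x *m J x - dJ w x
      - J x *m connection_mx h j (w *m J x) (transition x)) =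
    w *m (connection_mx h i v x *m J x - dJ v x
      - J x *m connection_mx h j (v *m J x) (transition x)).
    rewrite !mulmxBr !mulmxA (connection_mxC h w v ix) (dtransition_mxC v w ox).
    by rewrite (connection_mxC h (w *m J x) (v *m J x) jx).
  have assoc (r : 'rV[R]_n) (X Y Z : 'M[R]_n) :
    r *m (X *m Y *m Z) = r *m X *m Y *m Z by rewrite !mulmxA.
  by move=> v; rewrite /B 2!assoc sym.
have : (connection_mx h i w x *m J x - dJ w x
  - J x *m connection_mx h j (w *m J x) (transition x)) = 0.
  have KJ : hmx h j (transition x) *m (J x)^T \in unitmx.
    by rewrite unitmx_mul hmx_unitmx// unitmx_tr transition_mx_unit.
  by move: B0; rewrite /B -mulmxA => /(canRL (mulmxK KJ)); rewrite mul0mx.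
by move/eqP; rewrite -addrA -opprD subr_eq0 => /eqP.
Qed.

End ChartChange.

(** * Chart-independence along the curve *)

Section CurveChartChange.
Context {R : realType} {n : nat} {N : smoothManifold R n}.
Context (h : riemannianMetric N) (u : R -> N) (su : smooth_curve u).
Context (i j : chart_index N).
Implicit Types t : R.

Local Notation c := (Defs.coord u i).
Local Notation J := (transition_mx i j).
Local Notation dom k t := (cdom (atlas k) (u t)).

Lemma coord_overlap t : dom i t -> dom j t -> overlap i j (c t).
Proof. by move=> it jt; exists (u t). Qed.

Lemma coord_transition t : dom i t -> Defs.coord u j t = transition i j (c t).
Proof. by move=> it; rewrite /transition /Defs.coord cmapK. Qed.

Lemma velocity_transition t : dom i t -> dom j t ->
  velocity u j t = velocity u i t *m J (c t).
Proof.
move=> it jt; have ox := coord_overlap it jt.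
have nc : \near t, (transition i j \o c) t = Defs.coord u j t.
  by apply: filterS (near_cdom su it) => s si; rewrite [RHS]coord_transition.
have td : differentiable (transition i j) (c t).
  by apply: differentiable_mx => k; exact: differentiable_transition_coord.
have [_] := near_eq_is_derive nc (is_derive_comp td (is_derive_coord su it)).
have [_ ->] := is_derive_transition (velocity u i t) ox.
by move=> <-; rewrite -derive1E.
Qed.

(** The derivative of the Jacobian along the curve, which appears when the
    transformation law of the velocity is differentiated, is absorbed by the
    inhomogeneous term in the law of the connection matrix. *)
Lemma tension_transition t : dom i t -> dom j t ->
  tension h u j t = tension h u i t *m J (c t).
Proof.
move=> it jt; have ox := coord_overlap it jt.
have Jd : is_derive t 1 (fun s => J (c s)) (dtransition_mx i j (velocity u i t) (c t)).
  apply/is_derive_mxP => a b.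
  have abd : differentiable (fun x => J x a b) (c t).
    under eq_fun do rewrite mxE.
    exact: differentiable_pderiv_transition.
  have := is_derive_comp abd (is_derive_coord su it).
  have [_] := (is_derive_mxP _ _ _ _).1
    (is_derive_transition_mx (velocity u i t) ox) a b.
  by move=> ->.
have near_velocity : \near t, velocity u i t *m J (c t) = velocity u j t.
  by apply: filterS2 (near_cdom su it) (near_cdom su jt) => s si sj;
    rewrite -velocity_transition.
have [_ E] := near_eq_is_derive near_velocity
  (is_derive_mulmx (derivableP (derivable_velocity su it)) Jd).
rewrite /tension !covE derive1E E -derive1E (velocity_transition it jt).
rewrite (coord_transition it) mulmxDl -!mulmxA connection_mx_transition//.
by rewrite mulmxDr addrA.
Qed.

Lemma section_inner_transition (V W V' W' : R -> 'rV[R]_n) t :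
  dom i t -> dom j t -> V' t = V t *m J (c t) -> W' t = W t *m J (c t) ->
  section_inner h u j V' W' t = section_inner h u i V W t.
Proof.
move=> it jt VE WE; rewrite /section_inner /inner VE WE trmx_mul.
by rewrite (hmx_transition h (coord_overlap it jt)) -coord_transition// !mulmxA.
Qed.

Lemma sec_norm_transition (V V' : R -> 'rV[R]_n) t :
  dom i t -> dom j t -> V' t = V t *m J (c t) ->
  sec_norm h u j V' t = sec_norm h u i V t.
Proof. by move=> it jt VE; congr Num.sqrt; exact: section_inner_transition. Qed.

Lemma chart_flux_transition p t : dom i t -> dom j t ->
  chart_flux h u j p t = chart_flux h u i p t.
Proof.
move=> it jt; apply: section_inner_transition => //.
  rewrite /ptension (sec_norm_transition it jt (tension_transition it jt)).
  by rewrite tension_transition// scalemxAl.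
exact: velocity_transition.
Qed.

(** The first integral contains the covariant derivative of |tau|^(p-2) tau. Its
    invariance is read off from that of the flux, whose derivative differs from
    it by an invariant multiple of |tau|^p. *)
Lemma chart_first_integral_transition p t : 2 <= p -> dom i t -> dom j t ->
  derivable (ptension h u i p) t 1 -> derivable (ptension h u j p) t 1 ->
  chart_first_integral h u j p t = chart_first_integral h u i p t.
Proof.
move=> p2 it jt ip jp.
have nF : \near t, chart_flux h u i p t = chart_flux h u j p t.
  apply: filterS2 (near_cdom su it) (near_cdom su jt) => s si sj.
  by rewrite [RHS]chart_flux_transition.
have [_ Ei] := near_eq_is_derive nF (is_derive_chart_flux p2 su it ip).
have [_ Ej] := is_derive_chart_flux p2 su jt jp.
move: Ei; rewrite Ej (sec_norm_transition it jt (tension_transition it jt)).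
exact: addIr.
Qed.

End CurveChartChange.

Section Invariants.
Context {R : realType} {n : nat} {N : smoothManifold R n}.
Context (h : riemannianMetric N) (u : R -> N) (su : smooth_curve u).
Implicit Types t : R.

Local Notation dom k t := (cdom (atlas k) (u t)).

Lemma chart_atP t : dom (chart_at (u t)) t.
Proof. exact: projT2 (cid (atlas_cover (u t))). Qed.

Lemma tension_normE i t : dom i t ->
  tension_norm h u t = sec_norm h u i (tension h u i) t.
Proof.
move=> it; apply: (sec_norm_transition _ it (chart_atP t)).
exact: tension_transition su _ _ _ it (chart_atP t).
Qed.

Lemma differential_normE i t : dom i t ->
  differential_norm h u t = sec_norm h u i (velocity u i) t.
Proof.
move=> it; apply: (sec_norm_transition _ it (chart_atP t)).
exact: velocity_transition su _ _ _ it (chart_atP t).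
Qed.

Lemma is_derive_sqr_differential_norm t :
  is_derive t 1 (fun t => differential_norm h u t ^+ 2)
    (2 * section_inner h u (chart_at (u t)) (tension h u (chart_at (u t)))
      (velocity u (chart_at (u t))) t).
Proof.
have it := chart_atP t.
have vd := derivable_velocity su it.
set i := chart_at (u t) in it vd *.
have sq : \near t,
    section_inner h u i (velocity u i) (velocity u i) t = differential_norm h u t ^+ 2.
  apply: filterS (near_cdom su it) => s si.
  by rewrite (differential_normE si) sqr_sec_norm.
have := near_eq_is_derive sq (is_derive_section_inner h su it vd vd).
rewrite -/(tension h u i) (section_innerC h _ (tension h u i) it).
by apply: is_derive_ext => //; rewrite mulr_natl mulr2n.
Qed.

Lemma continuous_differential_norm : continuous (differential_norm h u).
Proof.
have -> : differential_norm h u = Num.sqrt \o (fun t => differential_norm h u t ^+ 2).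
  by apply/funext => t /=; rewrite sqrtr_sqr ger0_norm// sqrtr_ge0.
move=> t; apply: continuous_comp; last exact: sqrt_continuous.
apply/differentiable_continuous/derivable1_diffP.
by have [] := is_derive_sqr_differential_norm t.
Qed.

End Invariants.

Section Global.
Context {R : realType} {n : nat} {N : smoothManifold R n}.
Context (h : riemannianMetric N) (p : R) (u : R -> N).
Context (p2 : 2 <= p) (hu : pbiharmonic h u p).
Implicit Types t : R.

Local Notation dom k t := (cdom (atlas k) (u t)).

Let su : smooth_curve u := hu.1.

Definition flux t : R := chart_flux h u (chart_at (u t)) p t.
Definition first_integral t : R := chart_first_integral h u (chart_at (u t)) p t.

Lemma is_derive_flux t : is_derive t 1 flux
  (first_integral t + (2 * p - 1) / p * tension_norm h u t `^ p).
Proof.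
have it := chart_atP u t; have [ptd _ _] := hu.2 _ _ it.
apply: near_eq_is_derive (is_derive_chart_flux p2 su it ptd).
apply: filterS (near_cdom su it) => s si.
by rewrite /flux -(chart_flux_transition h su p si (chart_atP u s)).
Qed.

Lemma is_derive_first_integral t : is_derive t 1 first_integral 0.
Proof.
have it := chart_atP u t; have [ptd dptd E] := hu.2 _ _ it.
apply: near_eq_is_derive (is_derive_chart_first_integral p2 su it ptd dptd E).
apply: filterS (near_cdom su it) => s si.
have [sp _ _] := hu.2 _ _ si; have [sp' _ _] := hu.2 _ _ (chart_atP u s).
by rewrite /first_integral (chart_first_integral_transition su p2 si (chart_atP u s) sp sp').
Qed.

Lemma continuous_powR_tension_norm : continuous (fun t => tension_norm h u t `^ p).
Proof.
move=> t; have it := chart_atP u t; have [ptd _ _] := hu.2 _ _ it.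
apply/differentiable_continuous/derivable1_diffP.
have [+ _] := is_derive_section_inner h su it ptd (derivable_tension (h:=h) su it).
apply: near_eq_derivable; apply: filterS (near_cdom su it) => s si.
by rewrite (tension_normE h su si); exact: ptension_tension.
Qed.

Lemma flux_le t :
  `|flux t| <= tension_norm h u t `^ p + differential_norm h u t `^ p.
Proof. exact (chart_flux_le h p2 (chart_atP u t)). Qed.

End Global.

(** * Integrable functions on the line *)

Section Rigidity.
Context {R : realType}.
Local Notation mu := (@lebesgue_measure R).

Section Majorant.
Context (g : R -> R) (mg : measurable_fun setT g) (g0 : forall t, 0 <= g t).
Hypothesis gint : (\int[mu]_(t in setT) (g t)%:E < +oo)%E.

Definition total_mass : R := fine (\int[mu]_(t in setT) (g t)%:E).

Lemma total_massE : ((total_mass)%:E = \int[mu]_(t in setT) (g t)%:E)%E.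
Proof.
rewrite fineK// ge0_fin_numE//; apply: integral_ge0 => t _.
by rewrite lee_fin.
Qed.

Lemma increment_le_total_mass (K k : R -> R) (a b : R) : a < b ->
  continuous k -> (forall t : R, is_derive t 1 K (k t)) ->
  (forall t, a <= t <= b -> 0 <= k t <= g t) -> K b - K a <= total_mass.
Proof.
move=> ab kc Kd kg.
have Kc : continuous K.
  by move=> t; apply/differentiable_continuous/derivable1_diffP; case: (Kd t).
have ftc : (\int[mu]_(t in `[a, b]) (k t)%:E = (K b)%:E - (K a)%:E)%E.
  apply: continuous_FTC2 => //.
  - exact: continuous_subspaceT.
  - split=> [t _| |]; first by case: (Kd t).
    + apply: cvg_at_right_filter; exact: Kc.
    + apply: cvg_at_left_filter; exact: Kc.
  - by move=> t _; rewrite derive1E; case: (Kd t).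
rewrite -lee_fin EFinB -ftc total_massE.
have mk : measurable_fun setT k by exact: continuous_measurable_fun.
apply: (@le_trans _ _ (\int[mu]_(t in `[a, b]) (g t)%:E)%E).
  apply: ge0_le_integral => //.
  - by move=> t /=; rewrite in_itv/= lee_fin => /kg/andP[].
  - by apply/measurable_EFinP; exact: measurable_funTS.
  - by apply/measurable_EFinP; exact: measurable_funTS.
  - by move=> t /=; rewrite in_itv/= lee_fin => /kg/andP[].
apply: ge0_subset_integral => //; first exact/measurable_EFinP.
by move=> t _; rewrite lee_fin.
Qed.

Lemma length_le_total_mass (d a b : R) : 0 <= d -> a < b ->
  (forall t, a <= t <= b -> d <= g t) -> d * (b - a) <= total_mass.
Proof.
move=> d0 ab dg.
have -> : d * (b - a) = d * b - d * a by ring.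
apply: (@increment_le_total_mass ( *%R d) (cst d)) => //.
- by move=> t; exact: cvg_cst.
- by move=> t; apply: is_derive_eq; rewrite /GRing.scale/= mulr1.
- by move=> t /dg ->; rewrite d0.
Qed.

Lemma no_lower_bound_right (d a : R) : 0 < d -> ~ (forall t, a <= t -> d <= g t).
Proof.
move=> d0 dg.
have M0 : 0 <= total_mass.
  by rewrite fine_ge0//; apply: integral_ge0 => t _; rewrite lee_fin.
have L0 : 0 < (total_mass + 1) / d by rewrite divr_gt0// ltr_wpDl.
have := @length_le_total_mass d a (a + (total_mass + 1) / d) (ltW d0).
rewrite ltrDl L0 => /(_ isT) => bound.
have : d * (a + (total_mass + 1) / d - a) <= total_mass.
  by apply: bound => t /andP[/dg].
by rewrite addrC addKr mulrC divfK ?gt_eqF// gerDl ler10.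
Qed.

Lemma no_lower_bound_left (d b : R) : 0 < d -> ~ (forall t, t <= b -> d <= g t).
Proof.
move=> d0 dg.
have M0 : 0 <= total_mass.
  by rewrite fine_ge0//; apply: integral_ge0 => t _; rewrite lee_fin.
have L0 : 0 < (total_mass + 1) / d by rewrite divr_gt0// ltr_wpDl.
have := @length_le_total_mass d (b - (total_mass + 1) / d) b (ltW d0).
rewrite gtrBl L0 => /(_ isT) => bound.
have : d * (b - (b - (total_mass + 1) / d)) <= total_mass.
  by apply: bound => t /andP[_ /dg].
by rewrite subKr mulrC divfK ?gt_eqF// gerDl ler10.
Qed.

(** If [C < 0], then [F] is at most an affine function of slope [C] plus a
    multiple of the integral of [g], so it tends to -oo at +oo and its absolute
    value is not integrable. Hence [C >= 0] and [F] is nondecreasing; a nonzero value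
    of [F] would bound [g] from below on a half-line, so [F] is zero, and both
    nonnegative terms of its derivative vanish. *)
Lemma integrable_affine_growth (F f : R -> R) (C c : R) : 0 < c ->
  continuous f -> (forall t, 0 <= f t <= g t) ->
  (forall t, `|F t| <= g t) -> (forall t : R, is_derive t 1 F (C + c * f t)) ->
  forall t, f t = 0.
Proof.
move=> c0 fc fg Fg Fd.
have Fder t : derivable F t 1 by case: (Fd t).
have Fval t : F^`()%classic t = C + c * f t by rewrite derive1E; case: (Fd t).
have C0 : 0 <= C.
  rewrite leNgt; apply/negP => Cneg.
  have growth b : 0 < b -> F b <= F 0 + C * b + c * total_mass.
    move=> b0.
    have : c^-1 * (F b - C * b) - c^-1 * (F 0 - C * 0) <= total_mass.
      apply: (@increment_le_total_mass (fun t => c^-1 * (F t - C * t)) f) => //.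
      move=> t; have Ft := Fd t.
      by apply: is_derive_eq; rewrite /GRing.scale/= mulr1 addrC addKr mulKf ?gt_eqF.
    rewrite -mulrBr mulrC ler_pdivrMr// => H; move: H; lra.
  (* Beyond [b0] the affine bound on [F] is at most [-1]. *)
  pose b0 := Num.max 1 ((F 0 + c * total_mass + 1) / - C).
  apply: (@no_lower_bound_right 1 b0) => // t bt.
  apply: le_trans (Fg t).
  have t0 : 0 < t by rewrite (lt_le_trans _ bt)// lt_max ltr01.
  have : (F 0 + c * total_mass + 1) / - C <= t.
    by rewrite (le_trans _ bt)// le_max lexx orbT.
  rewrite ler_pdivrMr ?oppr_gt0// => Ct.
  rewrite -normrN; apply: le_trans (ler_norm _).
  have := growth t t0; move: Ct; lra.
have Fmono s t : s <= t -> F s <= F t.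
  move=> st; apply: (@ger0_derive1_ndecr _ F s t) => //.
  - by move=> r _; rewrite Fval addr_ge0// mulr_ge0 ?(ltW c0)//; case/andP: (fg r).
  - apply: derivable_within_continuous => r _; exact: Fder.
have F0 t : F t = 0.
  apply/eqP; rewrite eq_le; apply/andP; split; rewrite leNgt; apply/negP => Ft.
    apply: (@no_lower_bound_right (F t) t Ft) => s ts.
    by rewrite (le_trans (Fmono _ _ ts))// (le_trans (ler_norm _)).
  apply: (@no_lower_bound_left (- F t) t); first by rewrite oppr_gt0.
  move=> s st; rewrite (le_trans _ (Fg s))// -normrN (le_trans _ (ler_norm _))//.
  by rewrite lerN2 Fmono.
move=> t; have := Fval t.
have -> : F = cst 0 by apply/funext => s; exact: F0.
rewrite derive1_cst => /eqP; rewrite eq_sym paddr_eq0//; last first.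
  by rewrite mulr_ge0 ?(ltW c0)//; case/andP: (fg t).
by rewrite mulf_eq0 (gt_eqF c0)/= => /andP[_ /eqP].
Qed.

End Majorant.
End Rigidity.

(** * Locally constant maps, and the theorem *)

(** The indicator of the set where [u] takes its value at [0] is locally
    constant, so it has derivative zero. *)
Lemma locally_constant_is_constant {R : realType} {A : Type} (u : R -> A) :
  (forall t, \forall s \near t, u s = u t) -> forall t, u t = u 0.
Proof.
move=> uloc t; pose f s : R := `[< u s = u 0 >]%:R.
have fd s : is_derive s (1 : R) f 0.
  have near_f : \forall r \near s, cst (f s) r = f r.
    by apply: filterS (uloc s) => r rs; rewrite /f rs.
  exact: near_eq_is_derive near_f (is_derive_cst _ _ _).
have := is_derive_0_is_cst t 0 fd; rewrite /f [in RHS]asboolT//.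
by case: asboolP => // _ /eqP; rewrite eq_sym oner_eq0.
Qed.

Lemma near_derive0_constant {R : realType} {n} (f : R -> 'rV[R]_n) (t : R) :
  (\forall s \near t, is_derive (s : R) 1 f 0) -> \forall s \near t, f s = f t.
Proof.
move=> /nbhs_ballP[e /= e0 fd]; apply/nbhs_ballP; exists e => //= s se.
apply/rowP => k.
have kd (r : R) : ball t e r -> is_derive r 1 (fun r => f r 0 k) 0.
  by move=> /fd /is_derive_mxP/(_ 0 k); rewrite mxE.
have between a b : a <= b -> ball t e a -> ball t e b -> f a 0 k = f b 0 k.
  move=> ab ta tb.
  have inball r : a <= r <= b -> ball t e r.
    move: ta tb; rewrite /ball/= !ltr_norml => /andP[? ?] /andP[? ?] /andP[? ?].
    by apply/andP; split; lra.
  have [| |c _] := @MVT_segment _ (fun r => f r 0 k) (fun=> 0) a b ab.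
  - move=> r; rewrite in_itv/= => /andP[/ltW ar /ltW rb].
    by apply: kd; apply: inball; rewrite ar.
  - apply: derivable_within_continuous => r; rewrite in_itv/= => rab.
    by case: (kd r (inball r rab)).
  - by rewrite mul0r => /eqP; rewrite subr_eq0 => /eqP.
have tt := ballxx t e0.
by have [st|/ltW ts] := leP s t; [exact: between | rewrite -(between t s)].
Qed.

Section Conclusion.
Context {R : realType} {n : nat} {N : smoothManifold R n}.
Context (h : riemannianMetric N) (u : R -> N).

Lemma constant_of_differential_norm_eq0 : smooth_curve u ->
  (forall t, differential_norm h u t = 0) -> forall t, u t = u 0.
Proof.
move=> su du0; apply: locally_constant_is_constant => t.
have it := chart_atP u t; set i := chart_at (u t) in it.
have near_i := near_cdom su it.
have c0 : \forall s \near t, is_derive (s : R) 1 (Defs.coord u i) 0.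
  apply: filterS near_i => s si.
  have := is_derive_coord su si.
  suff -> : velocity u i s = 0 by [].
  by apply: (sec_norm_eq0 (h := h) si); rewrite -(differential_normE h su si).
apply: filterS2 near_i (near_derive0_constant c0) => s si ce.
by rewrite -[LHS](cmapK si) -[RHS](cmapK it); congr cinv.
Qed.

End Conclusion.

Theorem theorem4p1 (R : realType) (n : nat) (N : smoothManifold R n)
    (h : riemannianMetric N) (p : R) (u : R -> N)
    (hp : 2 <= p)
    (hu : pbiharmonic h u p)
    (hint : (\int[@lebesgue_measure R]_(t in [set: R])
       (tension_norm h u t `^ p + differential_norm h u t `^ p)%:E < +oo)%E) :
  exists q : N, forall t : R, u t = q.
Proof.
have su : smooth_curve u := hu.1.
have p0 : 0 < p by move: hp; lra.
pose g t := tension_norm h u t `^ p + differential_norm h u t `^ p.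
have mg : measurable_fun setT g.
  apply: measurable_funD.
    apply: continuous_measurable_fun.
    exact: (continuous_powR_tension_norm hp hu).
  have md : measurable_fun setT (differential_norm h u).
    by apply: continuous_measurable_fun; exact: continuous_differential_norm.
  exact: measurableT_comp (measurable_powR p) md.
have g0 t : 0 <= g t by rewrite addr_ge0 ?powR_ge0.
(* The first integral is a constant [C], so the flux has slope [C] up to a
   nonnegative multiple of |tau|^p. *)
pose C := first_integral h p u 0.
have fluxd (t : R) : is_derive t 1 (flux h p u)
    (C + (2 * p - 1) / p * tension_norm h u t `^ p).
  have -> : C = first_integral h p u t.
    by apply: is_derive_0_is_cst => s; exact: is_derive_first_integral.
  exact: is_derive_flux.
have tau_p t : tension_norm h u t `^ p = 0.
  apply: (integrable_affine_growth mg g0 hint _ _ _ _ fluxd).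
  - by rewrite divr_gt0//; move: hp; lra.
  - exact: continuous_powR_tension_norm hp hu.
  - by move=> s; rewrite powR_ge0 lerDl powR_ge0.
  - by move=> s; exact: flux_le.
have tau0 t : tension_norm h u t = 0 by apply/powR_eq0_eq0/tau_p.
(* With tau = 0 the curve is a geodesic, and its speed is constant. *)
have sq_cst t : differential_norm h u t ^+ 2 = differential_norm h u 0 ^+ 2.
  apply: (is_derive_0_is_cst (f := fun t => differential_norm h u t ^+ 2)) => s.
  have := is_derive_sqr_differential_norm h su s.
  rewrite section_inner_eq0l ?mulr0//.
  by apply: (sec_norm_eq0 (h := h) (chart_atP u s)); exact: tau0.
have speed_cst t : differential_norm h u t = differential_norm h u 0.
  by apply/eqP; have /eqP := sq_cst t; rewrite eqrXn2// sqrtr_ge0.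
exists (u 0); apply: (constant_of_differential_norm_eq0 (h := h) su) => t.
rewrite speed_cst; apply/eqP/negPn/negP => v0.
have d0 : 0 < differential_norm h u 0 `^ p.
  by rewrite powR_gt0// lt_neqAle eq_sym v0 sqrtr_ge0.
apply: (no_lower_bound_right (a := 0) mg g0 hint d0) => s _.
by rewrite /g speed_cst lerDr powR_ge0.
Qed.
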